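(* Let $A,B\in\mathbb R[x]$ with $\gcd(A,B)=1$ and let $p\in\mathbb R$ with $B(p)\neq0$. For integers $n\le-2$ let $\psi_n(u)\in\mathbb R[u,u^{-1}]$ be the Laurent polynomial defined in the context. Then the transition matrix from the standard Laurent monomials $u^l$ to the family $\{\psi_n\}_{n\le-2}$ (whose $(l,n)$ entry is the coefficient of $u^l$ in $\psi_n$) is triangular and banded: the $(l,n)$ entry vanishes unless $n\le l\le n+h$. Its diagonal entry corresponding to $n$ (the coefficient of $u^n$ in $\psi_n$) is $(n+1)B(p)$, and therefore is nonzero for every $n\le-2$.
   Context: $A/B$ is the logarithmic derivative $K'/K$ of a nonvanishing differentiable function $K$ on a real interval. Set $W=B'+A$ and $u=x-p$. Expand $B(x)=\sum_{j=0}^{b}c_ju^j$ and $W(x)=\sum_{j=0}^{w}d_ju^j$, where $b=\deg B$, $w=\deg W$ (if $W=0$ take $w=0$, $d_0=0$), and put $c_j=d_j=0$ for $j$ outside the respective range. Let $h=\max\{b,w+1\}$. For $n\le-2$, $$\psi_n(u)=\sum_{l=n}^{n+h}\bigl[(n+1)c_{l-n}+d_{l-n-1}\bigr]u^l .$$ *)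

(* Defs.v *)
From HB Require Import structures.
From mathcomp Require Import all_boot all_order all_algebra.
From mathcomp Require Import all_classical all_reals.
From mathcomp Require Import topology normedtype.
(* not imported: its notation levels are incompatible with those of
   mathcomp-analysis; as a consequence its canonical instances are not active *)
From mathcomp Require monalg.

Set Implicit Arguments.
Unset Strict Implicit.
Unset Printing Implicit Defensive.

Import Order.TTheory GRing.Theory Num.Theory.
Import numFieldNormedType.Exports.

Local Open Scope classical_set_scope.
Local Open Scope ring_scope.

(* The derivative is taken within the interval I, hence one-sided at an endpoint
   that belongs to I. Since division is total, the condition that the
   denominator of A/B does not vanish on I is stated separately. *)
Definition is_log_derivative_on (R : realType) (I : interval R) (K : R -> R)
    (A B : {poly R}) : Prop :=
  forall x : R, x \in I ->
    [/\ K x != 0, B.[x] != 0 &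
        exists K' : R,
          (fun y : R => (K y - K x) / (y - x)) @ within [set` I] (x^') --> K'
          /\ K' / K x = A.[x] / B.[x]].

(* R[u, u^-1] as the free R-module on the monomials u^l, l : int, which is all
   the structure needed to speak about coefficients. ({malg R[int]} has no ring
   structure, as the monomials of monalg have no inverses.) *)
Definition laurent (R : realType) : lmodType R :=
  monalg.monalg_malg__canonical__GRing_Lmodule int R.

Definition laurent_mon (R : realType) (l : int) : laurent R :=
  monalg.mkmalgU l 1.

Definition laurent_coef (R : realType) (f : laurent R) (l : int) : R :=
  monalg.mcoeff l f.

(* The coefficient of (x - p)^j in the expansion of Q at p, extended by 0 to
   all j : int: substituting x = p + u turns Q(x) into a polynomial in u. *)
Definition expansion_coef (R : realType) (Q : {poly R}) (p : R) (j : int) : R :=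
  match j with
  | Posz k => (Q \Po ('X + p%:P))`_k
  | Negz _ => 0
  end.

Lemma expansion_coefE (R : realType) (Q : {poly R}) (p : R) :
  Q = \sum_(j < (size Q).-1.+1) expansion_coef Q p j%:Z *: ('X - p%:P) ^+ j.
Proof.
have [->|Q_neq0] := eqVneq Q 0.
  by rewrite big1// => j _; rewrite /expansion_coef comp_poly0 coef0 scale0r.
rewrite prednK ?size_poly_gt0//.
have -> : size Q = size (Q \Po ('X + p%:P)).
  by rewrite size_comp_poly2// size_XaddC.
rewrite /expansion_coef -comp_polyE -comp_polyA comp_polyD comp_polyX comp_polyC.
by rewrite subrK comp_polyXr.
Qed.

Section Psi.
Variables (R : realType) (A B : {poly R}) (p : R).

Definition W : {poly R} := B^`() + A.

(* (size Q).-1 is the degree of Q, and 0 if Q = 0. *)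
Definition bandwidth : nat := maxn (size B).-1 ((size W).-1).+1.

(* l = n + k runs over the integers from n to n + h. *)
Definition psi (n : int) : laurent R :=
  \sum_(k < bandwidth.+1)
    let l := n + k%:Z in
    ((n + 1)%:~R * expansion_coef B p (l - n) + expansion_coef W p (l - n - 1))
      *: laurent_mon R l.

End Psi.

Definition transition_mx (R : realType) (f : int -> laurent R) (l n : int) : R :=
  laurent_coef (f n) l.

(* Main.v *)
Require Import Defs.
From HB Require Import structures.
From mathcomp Require Import all_boot all_order all_algebra.
From mathcomp Require Import all_classical all_reals.
From mathcomp Require Import topology normedtype.

Set Implicit Arguments.
Unset Strict Implicit.
Unset Printing Implicit Defensive.

Import Order.TTheory GRing.Theory Num.Theory.
Import numFieldNormedType.Exports.

Local Open Scope classical_set_scope.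
Local Open Scope ring_scope.

(** The exponents [n + k] in [psi n] are pairwise distinct, so each entry of the matrix is either
    one explicit summand or zero, and the band is just the range of [k]. On the diagonal the two
    indices are 0 and -1: the first gives the constant term of [B] expanded at [p], that is [B.[p]],
    the second gives 0 by convention. The factor [n + 1] cannot vanish when [n <= -2].
    [transition_mx_psi] carries the argument. *)

Lemma laurent_coef_sum (R : realType) (T : Type) (r : seq T) (c : T -> R)
    (m : T -> int) (l : int) :
  laurent_coef (\sum_(i <- r) c i *: laurent_mon R (m i)) l =
  \sum_(i <- r) c i * (m i == l)%:R.
Proof.
elim/big_ind2: _ => [|f a g b <- <-|i _].
- exact: monalg.mcoeff0.
- exact: monalg.mcoeffD.
- rewrite -[(m i == l)%:R]/(1 *+ (m i == l)) -monalg.mcoeffU.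
  exact: monalg.mcoeffZ.
Qed.

(** The map sending [k] to [n + k] is injective, so at most one summand of [psi] meets the monomial
    of exponent [l], and one does exactly when [l] lies in the band. *)
Lemma transition_mx_psi (R : realType) (A B : {poly R}) (p : R) (l n : int) :
  transition_mx (psi A B p) l n =
  if n <= l <= n + (bandwidth A B)%:Z
  then (n + 1)%:~R * expansion_coef B p (l - n)
       + expansion_coef (W A B) p (l - n - 1)
  else 0.
Proof.
rewrite /transition_mx /psi laurent_coef_sum.
case: ifP => [/andP[le_nl le_lh]|lNband].
- have [k lE] : exists k : nat, l = n + k%:Z.
    by exists `|l - n|%N; rewrite gez0_abs ?subr_ge0// [RHS]addrC subrK.
  have ltk : (k < (bandwidth A B).+1)%N by move: le_lh; rewrite lE lerD2l.
  (* The summand of index [k = l - n] is isolated; the others have exponent different from [l]. *)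
  rewrite (bigD1 (Ordinal ltk))//= -lE eqxx mulr1 big1 ?addr0// => i neq_ik.
  rewrite lE (inj_eq (addrI n)) eqz_nat -[k]/(val (Ordinal ltk)) (inj_eq val_inj).
  by rewrite (negPf neq_ik) mulr0.
- apply: big1 => k _; case: eqVneq => [lE|_]; last by rewrite mulr0.
  by move: lNband; rewrite -lE lerDl lerD2l !lez_nat leq0n leq_ord.
Qed.

(** The constant term of [Q(X + p)] is its value at 0. *)
Lemma expansion_coef0 (R : realType) (Q : {poly R}) (p : R) :
  expansion_coef Q p 0 = Q.[p].
Proof. by rewrite /= -horner_coef0 horner_comp !hornerE. Qed.

Theorem proposition2p6 (R : realType) (A B : {poly R})
    (I : interval R) (K : R -> R)
    (ndI : exists x y : R, [/\ x \in I, y \in I & x < y])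
    (logK : is_log_derivative_on I K A B)
    (copAB : coprimep A B) (p : R) (Bp_neq0 : B.[p] != 0) :
  let M := transition_mx (psi A B p) in
  forall n : int, n <= -2 ->
    [/\ forall l : int, ~~ (n <= l <= n + (bandwidth A B)%:Z) -> M l n = 0,
        M n n = (n + 1)%:~R * B.[p]
      & M n n != 0].
Proof.
move=> M n n_le; have MnE : M n n = (n + 1)%:~R * B.[p].
  rewrite /M transition_mx_psi lexx lerDl lez_nat leq0n/= subrr.
  (* the W-term has index -1, so it is 0 *)
  by rewrite expansion_coef0 addr0.
split=> // [l /negPf lNband|]; first by rewrite /M transition_mx_psi lNband.
rewrite MnE mulf_neq0// intr_eq0 addr_eq0.
(* The only root of [n + 1] is -1, just outside the range [n <= -2]. *)
by apply: contraTneq n_le => ->.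
Qed.
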